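(* Let $q\in\mathbb N$, let $\alpha_1,\dots,\alpha_{2q}$, $\beta_1,\dots,\beta_{2q}$, $x_1,\dots,x_{2q}$ be complex numbers, and let $\Lambda$ be the associated block Vandermonde matrix of order $2q$. Suppose that $\det(\Lambda)\ne0$, and write $$\Lambda^{-1}=\begin{pmatrix}Y\\Z\end{pmatrix},\qquad Y,Z\in\mathbb C^{q\times2q}.$$ For each $j=1,\dots,2q$, define the polynomials $$Y_j(x):=\sum_{k=0}^{q-1}Y_{k+1,j}x^k,\qquad Z_j(x):=\sum_{k=0}^{q-1}Z_{k+1,j}x^k.$$ Then $(Y_j,Z_j)$ is the unique pair of polynomials of degree at most $q-1$ satisfying $$\alpha_iY_j(x_i)+\beta_iZ_j(x_i)=\delta_{ij},\qquad i=1,\dots,2q.$$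
   Context: The block Vandermonde matrix of order $2q$ is the $2q\times2q$ matrix $\Lambda$ whose $i$-th row is $$(\alpha_i,\ \alpha_ix_i,\ \dots,\ \alpha_ix_i^{q-1},\ \beta_i,\ \beta_ix_i,\ \dots,\ \beta_ix_i^{q-1}),\qquad i=1,\dots,2q.$$ Polynomials have complex coefficients; $\delta_{ij}$ is the Kronecker delta. *)

(* Defs.v *)
From mathcomp Require Import all_boot all_order all_algebra.
From mathcomp Require Import reals.
From mathcomp Require Import complex.

Set Implicit Arguments.
Unset Strict Implicit.
Unset Printing Implicit Defensive.

Import GRing.Theory.
Local Open Scope ring_scope.
Local Open Scope complex_scope.

Section BlockVandermonde.
Variables (R : realType) (q : nat).
Implicit Types (alpha beta x : 'I_(q + q) -> R[i]) (W : 'M[R[i]]_(q, q + q)).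

Definition block_vandermonde alpha beta x : 'M[R[i]]_(q + q) :=
  row_mx (\matrix_(i < q + q, k < q) (alpha i * x i ^+ k))
         (\matrix_(i < q + q, k < q) (beta i * x i ^+ k)).

Definition col_poly W (j : 'I_(q + q)) : {poly R[i]} :=
  \sum_(k < q) W k j *: 'X^k.

(* Since [size p] is the degree plus one, [size p <= q] says that p has degree
   at most q - 1. *)
Definition dual_pair alpha beta x (j : 'I_(q + q))
    (PQ : {poly R[i]} * {poly R[i]}) : Prop :=
  [/\ (size PQ.1 <= q)%N, (size PQ.2 <= q)%N
    & forall i : 'I_(q + q),
        alpha i * PQ.1.[x i] + beta i * PQ.2.[x i] = (i == j)%:R].

End BlockVandermonde.

(* Main.v *)
Require Import Defs.
From mathcomp Require Import all_boot all_order all_algebra.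
From mathcomp Require Import reals complex.

Set Implicit Arguments.
Unset Strict Implicit.
Unset Printing Implicit Defensive.

Import GRing.Theory.
Local Open Scope ring_scope.
Local Open Scope complex_scope.

(** Identify a polynomial of degree less than [q] with its column of [q]
    coefficients. Applying the block Vandermonde matrix [L] to the stacked
    coefficients of P and Q evaluates alpha_i P(x_i) + beta_i Q(x_i) for all i
    at once ([block_vandermonde_mulE]), so the interpolation conditions on (P, Q)
    are exactly the square linear system [L *m u = col j 1%:M]
    ([dual_pair_linear_system]). When [L] is invertible, the only solution [u] is
    the [j]-th column of its inverse, which is the [j]-th column of [Y] stacked on
    that of [Z]. *)

Section CoefficientColumns.
Variables (K : nzRingType) (q : nat).
Implicit Types P Q : {poly K}.

Definition coef_col P : 'cV[K]_q := (poly_rV P)^T.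

Lemma coef_col_inj P Q :
  (size P <= q)%N -> (size Q <= q)%N -> coef_col P = coef_col Q -> P = Q.
Proof.
move=> sP sQ /trmx_inj ePQ.
by rewrite -(poly_rV_K sP) -(poly_rV_K sQ) ePQ.
Qed.

End CoefficientColumns.

Section LinearSystem.
Variables (R : realType) (q : nat).
Implicit Types (alpha beta x : 'I_(q + q) -> R[i]) (P Q : {poly R[i]}).

Lemma size_col_poly (W : 'M[R[i]]_(q, q + q)) j : (size (col_poly W j) <= q)%N.
Proof.
apply/leq_sizeP => m le_qm; rewrite coef_sum big1 // => k _.
by rewrite coefZ coefXn gtn_eqF ?mulr0 // (leq_trans (ltn_ord k)).
Qed.

Lemma coef_col_col_poly (W : 'M[R[i]]_(q, q + q)) j :
  coef_col q (col_poly W j) = col j W.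
Proof.
apply/colP => k; rewrite !mxE coef_sum (bigD1 k) //= big1 => [|l neq_lk].
  by rewrite coefZ coefXn eqxx mulr1 addr0.
by rewrite coefZ coefXn (inj_eq val_inj) eq_sym (negPf neq_lk) mulr0.
Qed.

(** Each half of a row of the matrix is a scalar times the powers of [x i], so
    its product with a coefficient column is a scaled polynomial evaluation. *)
Lemma block_vandermonde_mulE alpha beta x P Q i :
  (size P <= q)%N -> (size Q <= q)%N ->
  (block_vandermonde alpha beta x *m col_mx (coef_col q P) (coef_col q Q)) i 0 =
  alpha i * P.[x i] + beta i * Q.[x i].
Proof.
move=> sP sQ; rewrite mul_row_col (horner_coef_wide _ sP) (horner_coef_wide _ sQ).
rewrite !mxE !mulr_sumr.
by congr (_ + _); apply: eq_bigr => k _; rewrite !mxE -mulrA (mulrC (x i ^+ k)).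
Qed.

(** The row-by-row reading of the system is the list of interpolation
    conditions, because the Kronecker delta is a column of the identity. *)
Lemma dual_pair_linear_system alpha beta x j P Q :
  dual_pair alpha beta x j (P, Q) <->
  [/\ (size P <= q)%N, (size Q <= q)%N
    & block_vandermonde alpha beta x *m col_mx (coef_col q P) (coef_col q Q)
      = col j 1%:M].
Proof.
split=> -[/= sP sQ eqPQ]; split=> //=.
  by apply/colP => i; rewrite block_vandermonde_mulE // eqPQ !mxE.
by move=> i; rewrite -block_vandermonde_mulE // eqPQ !mxE.
Qed.

End LinearSystem.

Theorem theorem2p4 (R : realType) (q : nat)
    (alpha beta x : 'I_(q + q) -> R[i]) (Y Z : 'M[R[i]]_(q, q + q)) :
  \det (block_vandermonde alpha beta x) != 0 ->
  invmx (block_vandermonde alpha beta x) = col_mx Y Z ->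
  forall j : 'I_(q + q),
    unique (dual_pair alpha beta x j) (col_poly Y j, col_poly Z j).
Proof.
set L := block_vandermonde alpha beta x => detL invL j.
have unitL : L \in unitmx by rewrite unitmxE unitfE.
have stackYZ : col_mx (coef_col q (col_poly Y j)) (coef_col q (col_poly Z j))
               = col j (invmx L).
  by rewrite !coef_col_col_poly invL col_col_mx.
split.
  apply/dual_pair_linear_system; split; try exact: size_col_poly.
  by rewrite stackYZ -/L !colE !mulmxA mulmxV.
case=> P Q /dual_pair_linear_system [sP sQ sysPQ].
have : col_mx (coef_col q P) (coef_col q Q)
       = col_mx (coef_col q (col_poly Y j)) (coef_col q (col_poly Z j)).
  by rewrite stackYZ -[LHS](mulKmx unitL) sysPQ !colE mul1mx.
case/eq_col_mx => eqP eqQ.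
by congr (_, _); apply/esym; [move: eqP | move: eqQ]; apply: coef_col_inj => //;
   exact: size_col_poly.
Qed.
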